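(* Let $\mathcal{N}=(N,S)$ be a line segment net in $\mathbb{R}^d$ and let $U$ be a countable subgroup of the multiplicative group $\mathbb{R}_+$ of positive reals, acting on $\mathbb{R}^d$ by scaling. Then there exists a uniquely determined extension $\mathcal{N}_U$ of $\mathcal{N}$ such that (i) $U$ is a subgroup of the scaling group $D(\mathcal{N}_U)$ of $\mathcal{N}_U$; (ii) if $\mathcal{N}'$ is an extension of the net $\mathcal{N}$ whose scaling group contains $U$ as a subgroup, then $\mathcal{N}'$ is an extension of $\mathcal{N}_U$.
   Context: A line segment net (string-node net) $\mathcal{N}=(N,S)$ in $\mathbb{R}^d$ is a pair of sets such that: (a) $S$ (the strings) is a nonempty finite or countable set whose elements are lines, closed (nondegenerate) line segments or closed semi-infinite line segments in $\mathbb{R}^d$, such that distinct collinear strings are disjoint; (b) $N$ (the nodes) is nonempty, finite or countable, and is the set of intersection points of (distinct) strings. The body $|\mathcal{N}|$ is the union of the strings. An extension of $\mathcal{N}=(N,S)$ is a net $\mathcal{N}'=(N',S')$ in $\mathbb{R}^d$ with $N\subseteq N'$ and $|\mathcal{N}|\subseteq|\mathcal{N}'|$. The scaling group $D(\mathcal{N})$ is the multiplicative group of positive real numbers $r$ with $r|\mathcal{N}|=|\mathcal{N}|$. *)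

(* Defs.v *)
From mathcomp Require Import all_boot all_order all_algebra.
From mathcomp Require Import all_classical all_reals.

Set Implicit Arguments.
Unset Strict Implicit.
Unset Printing Implicit Defensive.

Import Order.TTheory GRing.Theory Num.Theory.

Local Open Scope classical_set_scope.
Local Open Scope ring_scope.

Section Strings.
Context {R : realType} {d : nat}.
Implicit Types (s t : set 'rV[R]_d) (p v : 'rV[R]_d).

(* The image of the parameter interval I under u |-> p + u *: v. *)
Definition line_image p v (I : set R) : set 'rV[R]_d :=
  [set p + u *: v | u in I].

Definition is_line s : Prop :=
  exists p v, v != 0 /\ s = line_image p v setT.

(* v != 0 makes the segment from p to p + v nondegenerate. *)
Definition is_closed_segment s : Prop :=
  exists p v, v != 0 /\ s = line_image p v `[0, 1].

Definition is_closed_half_line s : Prop :=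
  exists p v, v != 0 /\ s = line_image p v `[0, +oo[.

Definition is_string s : Prop :=
  [\/ is_line s, is_closed_segment s | is_closed_half_line s].

Definition collinear s t : Prop :=
  exists l, [/\ is_line l, s `<=` l & t `<=` l].

End Strings.

Record string_node_pair (R : realType) (d : nat) := StringNodePair {
  nodes : set 'rV[R]_d ;
  strings : set (set 'rV[R]_d) }.

Section Nets.
Context {R : realType} {d : nat}.
Implicit Types (N : string_node_pair R d) (r : R).

Definition intersection_points (S : set (set 'rV[R]_d)) : set 'rV[R]_d :=
  [set x | exists s t, [/\ S s, S t, s <> t, s x & t x]].

(* [countable] includes the finite sets. *)
Record is_net N : Prop := IsNet {
  net_strings_nonempty : strings N !=set0 ;
  net_strings_countable : countable (strings N) ;
  net_strings_string : forall s, strings N s -> is_string s ;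
  net_collinear_disjoint : forall s t, strings N s -> strings N t ->
    s <> t -> collinear s t -> s `&` t = set0 ;
  net_nodes_nonempty : nodes N !=set0 ;
  net_nodes_countable : countable (nodes N) ;
  net_nodesE : nodes N = intersection_points (strings N) }.

Definition body N : set 'rV[R]_d := \bigcup_(s in strings N) s.

(* [is_extension N N'] reads: N' is an extension of N. *)
Definition is_extension N N' : Prop :=
  [/\ is_net N', nodes N `<=` nodes N' & body N `<=` body N'].

Definition scaling_group N : set R :=
  [set r | 0 < r /\ [set r *: x | x in body N] = body N].

End Nets.

Definition positive_reals (R : realType) : set R := [set r | 0 < r].

(* U is a subgroup of G, for sets U and G of positive reals under
   multiplication. *)
Record is_mul_subgroup (R : realType) (U G : set R) : Prop := IsMulSubgroup {
  mul_subgroup_sub : U `<=` G ;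
  mul_subgroup1 : U 1 ;
  mul_subgroupM : forall r s, U r -> U s -> U (r * s) ;
  mul_subgroupV : forall r, U r -> U r^-1 }.

(* Main.v *)
(** By Sierpinski's theorem a closed interval is not the union of countably
    many, and at least two, disjoint nonempty closed sets. A string contained
    in the body of a net meets the strings of the net that lie on its line in
    disjoint closed intervals, and the countably many others in single points;
    so it is contained in one string. Hence the body of a net determines its
    strings and nodes, and an inclusion of bodies is already an extension.
    For r in U and a string s of N, every U-invariant extension of N has a
    unique string containing rs; the intersection of these strings is again a
    string, and the net N_U consists of these intersections. *)

Require Import Defs.
From mathcomp Require Import all_boot all_order all_algebra.
From mathcomp Require Import all_classical all_reals num_normedtype.
From mathcomp Require Import ring lra.

Set Implicit Arguments.
Unset Strict Implicit.
Unset Printing Implicit Defensive.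

Import Order.TTheory GRing.Theory Num.Theory.

Local Open Scope classical_set_scope.
Local Open Scope ring_scope.

(** * Sierpinski's theorem on an interval *)

Section Sierpinski.
Variables (R : realType) (T : Type) (f : R -> T) (lo hi : R).
(** For convex fibres, being closed means containing the endpoint of every half-open interval on
    which [f] takes that value, so closedness is stated once for each side. *)
Hypothesis fibre_convex : forall x y z, lo <= x -> x <= y -> y <= z ->
  z <= hi -> f x = f z -> f y = f x.
Hypothesis fibre_closedl : forall x y, lo <= x -> x < y -> y <= hi ->
  (forall z, x < z -> z <= y -> f z = f y) -> f x = f y.
Hypothesis fibre_closedr : forall x y, lo <= x -> x < y -> y <= hi ->
  (forall z, x <= z -> z < y -> f z = f x) -> f y = f x.

(** The fibre of [t] in [[x, y]] is empty or a closed interval. As [f x <> f y], it misses at least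
    one of the endpoints. The gap between the fibre and a missed endpoint has that endpoint's value
    somewhere violated, and a subinterval of the gap is cut off there. *)
Lemma subinterval_avoiding_fibre (t : T) x y :
  lo <= x -> x < y -> y <= hi -> f x <> f y ->
  exists x' y', [/\ x <= x', x' < y', y' <= y, f x' <> f y' &
    forall z, x' <= z -> z <= y' -> f z <> t].
Proof.
move=> lox xy yhi fxy; set A := [set z | [/\ x <= z, z <= y & f z = t]].
have [[a Aa]|A0] := pselect (A !=set0); last first.
  by exists x, y; split=> // z xz zy fz; apply: A0; exists z.
have [xa ay fa] := Aa.
have [fx|fx] := pselect (f x = t).
- have Asup : has_sup A by split; [exists a|exists y => z []].
  have Aub := sup_upper_bound Asup; set c := sup A.
  have ac : a <= c := Aub _ Aa.
  have cy : c <= y by apply: ge_sup; [exists a|move=> z []].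
  have below z : x <= z -> z < c -> f z = t.
    move=> xz zc; have [w [xw wy fw] zw] := sup_gt Asup.1 zc.
    by rewrite -fx; apply: (@fibre_convex x z w); rewrite ?fx ?fw //; lra.
  have fc : f c = t.
    have [xc|xc] := ltP x c; last by rewrite (_ : c = x) //; lra.
    rewrite -fx; apply: fibre_closedr; [lra|lra|lra|].
    by move=> z xz zc; rewrite fx below.
  have cy' : c < y.
    by rewrite lt_neqAle cy andbT; apply/eqP => cy'; rewrite cy' -fx in fc;
      apply: fxy.
  (* If [f] were constant on []c, y]], left closedness would put [c] into the fibre of [y], although
     [f c = t]. *)
  have [z [cz zy fz]] : exists z, [/\ c < z, z < y & f z <> f y].
    apply: contrapT => H; apply: fxy; rewrite fx -fc.
    apply: fibre_closedl; [lra|lra|lra|].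
    move=> z cz; rewrite le_eqVlt => /orP[/eqP->//|zy].
    by apply: contrapT => fz; apply: H; exists z.
  exists z, y; split=> //; first lra.
  move=> w zw wy fw; suff : w <= c by lra.
  by apply: Aub; split=> //; lra.
- have Ainf : has_inf A by split; [exists a|exists x => z []].
  have Alb := ge_inf Ainf.2; set c := inf A.
  have ca : c <= a := Alb _ Aa.
  have xc : x <= c by apply: lb_le_inf; [exists a|move=> z []].
  have above z : c < z -> z <= a -> f z = t.
    move=> cz za; have [w [xw wy fw] wz] := inf_lt Ainf.1 cz.
    by rewrite -fw; apply: (@fibre_convex w z a); rewrite ?fa ?fw //; lra.
  have fc : f c = t.
    have [ca'|ca'] := ltP c a; last by rewrite (_ : c = a) //; lra.
    rewrite -fa; apply: fibre_closedl; [lra|lra|lra|].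
    by move=> z xz zc; rewrite fa above.
  have xc' : x < c.
    by rewrite lt_neqAle xc andbT; apply/eqP => xc'; rewrite -xc' in fc.
  have [z [xz zc fz]] : exists z, [/\ x < z, z < c & f z <> f x].
    apply: contrapT => H; apply: fx; rewrite -fc.
    apply/esym/fibre_closedr; [lra|lra|lra|].
    move=> z; rewrite le_eqVlt => /orP[/eqP->//|xz] zc.
    by apply: contrapT => fz; apply: H; exists z.
  exists x, z; split=> //; [lra|exact/nesym|].
  move=> w xw wz fw; suff : c <= w by lra.
  by apply: Alb; split=> //; lra.
Qed.

End Sierpinski.

(** Nested intervals: if the endpoints had different values, one could shrink [[lo, hi]] repeatedly,
    avoiding the value [n] at step [n]. A point common to all the intervals would then have no value
    left. *)
Lemma countable_closed_convex_fibres (R : realType) (f : R -> nat) (lo hi : R) :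
  (forall x y z, lo <= x -> x <= y -> y <= z -> z <= hi ->
    f x = f z -> f y = f x) ->
  (forall x y, lo <= x -> x < y -> y <= hi ->
    (forall z, x < z -> z <= y -> f z = f y) -> f x = f y) ->
  (forall x y, lo <= x -> x < y -> y <= hi ->
    (forall z, x <= z -> z < y -> f z = f x) -> f y = f x) ->
  lo <= hi -> f lo = f hi.
Proof.
move=> conv cll clr; rewrite le_eqVlt => /orP[/eqP->//|lohi].
apply: contrapT => flohi.
pose bad p := [/\ lo <= p.1, p.1 < p.2, p.2 <= hi & f p.1 <> f p.2].
pose next n p q := [/\ bad q, p.1 <= q.1, q.2 <= p.2 &
  forall z, q.1 <= z -> z <= q.2 -> f z <> n].
(* The choice function is total, so [next] is demanded only of bad intervals; any other pair is
   returned unchanged. *)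
have /choice[g gP] : forall np : nat * (R * R), exists q, bad np.2 -> next np.1 np.2 q.
  move=> [n p]; have [/= [lox xy yhi fxy]|nb] := pselect (bad p); last by exists p.
  have [x [y [px xy' yp fxy' avoid]]] :=
    subinterval_avoiding_fibre conv cll clr n lox xy yhi fxy.
  by exists (x, y) => _; split=> //=; split=> //=; lra.
pose s := fix s n := if n is m.+1 then g (m, s m) else (lo, hi).
have sbad n : bad (s n) by elim: n => [|n /(gP (n, s n))[]//].
have snext n : next n (s n) (s n.+1) by exact: (gP (n, s n) (sbad n)).
have mono m k : (s m).1 <= (s (m + k)%N).1 /\ (s (m + k)%N).2 <= (s m).2.
  elim: k => [|k [IH1 IH2]]; first by rewrite addn0.
  rewrite addnS; have [_ ? ? _] := snext (m + k)%N.
  by split; lra.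
have cross m n : (s m).1 <= (s n).2.
  have [lem _] := mono m n; have [_] := mono n m; rewrite addnC => len.
  by have [_ /ltW lt _ _] := sbad (m + n)%N; apply: le_trans (le_trans lt len).
set A := range (fun n => (s n).1).
have A0 : A !=set0 by exists (s 0%N).1, 0%N.
have Asup : has_sup A by split=> //; exists hi => _ [n _ <-]; exact: (cross n 0%N).
(* The supremum of the left endpoints lies in every interval, in particular in the one with index
   [(f (sup A)).+1], which avoids the value [f (sup A)]. *)
have [_ _ _ avoid] := snext (f (sup A)).
apply: (avoid (sup A)) => //.
  by apply: sup_upper_bound => //; exists (f (sup A)).+1.
by apply: ge_sup => // _ [n _ <-]; exact: cross.
Qed.

(** * Strings as closed convex subsets of lines *)

(** Elements of [I] come arbitrarily close to the infimum, so convexity gives all of []inf I, b]];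
    closedness along this segment adds the endpoint. *)
Lemma is_interval_inf (R : realType) (I : set R) (b : R) :
  is_interval I -> (forall x y, (forall u, 0 < u -> u <= 1 -> I (x + u * y)) -> I x) ->
  I b -> has_lbound I -> I (inf I).
Proof.
move=> Iitv Icl Ib Ilb; have I0 : I !=set0 by exists b.
have cb : inf I <= b := ge_inf Ilb Ib.
apply: (Icl _ (b - inf I)) => u u0 u1.
have [cb'|bc] := ltP (inf I) b; last first.
  by rewrite (_ : inf I = b) ?subrr ?mulr0 ?addr0 //; lra.
have [|w Iw wu] := @inf_lt _ I (inf I + u * (b - inf I)) I0; first by nra.
by apply: (Iitv w b Iw Ib); nra.
Qed.

Lemma is_interval_sup (R : realType) (I : set R) (b : R) :
  is_interval I -> (forall x y, (forall u, 0 < u -> u <= 1 -> I (x + u * y)) -> I x) ->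
  I b -> has_ubound I -> I (sup I).
Proof.
move=> Iitv Icl Ib Iub; have I0 : I !=set0 by exists b.
have cb : b <= sup I by apply: sup_upper_bound.
apply: (Icl _ (b - sup I)) => u u0 u1.
have [cb'|bc] := ltP b (sup I); last first.
  by rewrite (_ : sup I = b) ?subrr ?mulr0 ?addr0 //; lra.
have [|w Iw wu] := @sup_gt _ I (sup I + u * (b - sup I)) I0; first by nra.
by apply: (Iitv b w Ib Iw); nra.
Qed.

Lemma ge0_of_segment (R : realType) (a b : R) :
  (forall u, 0 < u -> u <= 1 -> 0 <= a + u * b) -> 0 <= a.
Proof.
move=> H; rewrite leNgt; apply/negP => a0.
have b0 : - a <= b by have := H 1 ltr01 (lexx _); lra.
have b_gt0 : 0 < 2 * b by lra.
(* This parameter is at most 1/2 because [- a <= b], and it gives the negative value [a / 2]. *)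
have : 0 <= a + (- a / (2 * b)) * b.
  by apply: H; [apply: divr_gt0; lra | rewrite ler_pdivrMr //; lra].
by rewrite (_ : - a / (2 * b) * b = - a / 2); [lra | field; lra].
Qed.

Section StringGeometry.
Context {R : realType} {d : nat}.
Implicit Types (s t l : set 'rV[R]_d) (p v x y w : 'rV[R]_d).

Definition nondegenerate s := exists x y, [/\ x <> y, s x & s y].

Definition segment_convex s := forall x w u,
  s x -> s (x + w) -> 0 <= u -> u <= 1 -> s (x + u *: w).

(** Testing closedness along half-open segments suffices for convex subsets of a line, and the
    property passes to arbitrary intersections. *)
Definition segment_closed s := forall x w,
  (forall u, 0 < u -> u <= 1 -> s (x + u *: w)) -> s x.

Lemma line_param_inj p v (a b : R) : v != 0 -> p + a *: v = p + b *: v -> a = b.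
Proof.
move=> v0 /addrI/eqP; rewrite -subr_eq0 -scalerBl scaler_eq0 (negbTE v0) orbF.
by rewrite subr_eq0 => /eqP.
Qed.

Lemma line_imageP p v (I : set R) u : v != 0 -> line_image p v I (p + u *: v) <-> I u.
Proof.
by move=> v0; split=> [[b Ib /(line_param_inj v0) <-]//|Iu]; exists u.
Qed.

Lemma line_through l x y : is_line l -> l x -> l y -> x <> y ->
  l = line_image x (y - x) setT.
Proof.
move=> [p [v [v0 ->]]] [a _ <-] [b _ <-] xy.
have ab : b - a != 0 by apply/eqP => /subr0_eq ab; apply: xy; rewrite ab.
have -> : p + b *: v - (p + a *: v) = (b - a) *: v.
  by apply/rowP => i; rewrite !mxE; ring.
apply/seteqP; split=> _ [u _ <-].
  exists ((u - a) / (b - a)) => //.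
  by rewrite scalerA divfK // -addrA -scalerDl subrKC.
by exists (a + u * (b - a)) => //; rewrite scalerDl addrA scalerA.
Qed.

Lemma line_eq l l' x y : is_line l -> is_line l' ->
  x <> y -> l x -> l y -> l' x -> l' y -> l = l'.
Proof.
move=> ll ll' xy lx ly l'x l'y.
by rewrite (line_through ll lx ly xy) (line_through ll' l'x l'y xy).
Qed.

(** The three kinds of strings differ only in the parameter set, so they can be treated together
    through a closed interval [I] containing 0 and 1. *)
Lemma is_string_param s : is_string s -> exists p v (I : set R),
  [/\ v != 0, s = line_image p v I, I 0 /\ I 1, is_interval I &
   forall a b, (forall u, 0 < u -> u <= 1 -> I (a + u * b)) -> I a].
Proof.
move=> [] [p [v [v0 ->]]]; exists p, v; eexists; split; try by [eassumption|].
- by rewrite /= !in_itv /= !lexx ler01.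
- exact: interval_is_interval.
- move=> x y H; rewrite /= in_itv /=; apply/andP; split.
    apply: (@ge0_of_segment _ x y) => u u0 u1.
    by have := H u u0 u1; rewrite /= in_itv /= => /andP[].
  rewrite -subr_ge0; apply: (@ge0_of_segment _ _ (- y)) => u u0 u1.
  by have := H u u0 u1; rewrite /= in_itv /= => /andP[]; lra.
- by rewrite /= !in_itv /= !andbT lexx ler01.
- exact: interval_is_interval.
- move=> x y H; rewrite /= in_itv /= andbT.
  apply: (@ge0_of_segment _ x y) => u u0 u1.
  by have := H u u0 u1; rewrite /= in_itv /= andbT.
Qed.

Lemma line_image_segment_closed p v (I : set R) : v != 0 ->
  (forall a b, (forall u, 0 < u -> u <= 1 -> I (a + u * b)) -> I a) ->
  segment_closed (line_image p v I).
Proof.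
move=> v0 Icl x w H.
(* The parameters 1 and 1/2 give two points known to be on the line; solving for [x] and [w] places
   the limit point [x] on the line too. *)
have [a _ xw] := H 1 ltr01 (lexx _); have [||b _ xw2] := H (1 / 2); [lra|lra|].
have wE : w = (2 * (a - b)) *: v.
  apply: (addrI (x + (1 / 2) *: w)); apply/rowP => i.
  move/rowP/(_ i): xw; move/rowP/(_ i): xw2; rewrite !mxE; lra.
have xE : x = p + (2 * b - a) *: v.
  apply/rowP => i.
  move/rowP/(_ i): xw; move/rowP/(_ i): xw2; rewrite !mxE; lra.
rewrite xE; apply/line_imageP => //; apply: (Icl _ (2 * (a - b))) => u u0 u1.
apply/(line_imageP p _ _ v0).
by have := H u u0 u1; rewrite wE xE scalerA -addrA -scalerDl.
Qed.

(** For the converse, the parameters of [s] form a closed interval with at least two points. Its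
    boundedness on either side decides between segment, half-line (in direction [v] or [- v]) and
    line. This intrinsic form is what makes intersections of strings easy to recognize as
    strings. *)
Lemma is_stringP s : is_string s <->
  [/\ exists2 l, is_line l & s `<=` l, nondegenerate s,
      segment_convex s & segment_closed s].
Proof.
split=> [/is_string_param[p [v [I [v0 -> [I0 I1] Iitv Icl]]]]|].
  split.
  - by exists (line_image p v setT); [exists p, v|move=> _ [u _ <-]; exists u].
  - exists (p + 0 *: v), (p + 1 *: v); split; [|by exists 0|by exists 1].
    by move=> /(line_param_inj v0)/esym/eqP; rewrite oner_eq0.
  - move=> _ w u [a Ia <-] [b Ib bw] u0 u1.
    have -> : w = (b - a) *: v.
      by apply: (addrI (p + a *: v)); rewrite -bw -addrA -scalerDl subrKC.
    rewrite scalerA -addrA -scalerDl; apply/line_imageP => //.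
    have [ab|ba] := leP a b; [apply: (Iitv a b)|apply: (Iitv b a)] => //; nra.
  - exact: line_image_segment_closed.
move=> [[_ [p [v [v0 ->]]] sl] [x [y [xy sx sy]]] scv scl].
pose I := [set u | s (p + u *: v)].
have sE : s = line_image p v I.
  apply/seteqP; split=> [z sz|_ [u Iu <-]//].
  by have [u _ uz] := sl z sz; exists u => //; rewrite /I /= uz.
have Iitv : is_interval I.
  move=> a b Ia Ib c /andP[ac cb].
  have [ab|ab] := ltP a b; last by rewrite (_ : c = a) //; lra.
  rewrite /I /= (_ : c = a + (c - a) / (b - a) * (b - a)); last first.
    by field; rewrite subr_eq0 gt_eqF.
  rewrite scalerDl addrA -scalerA; apply: scv => //.
  - by rewrite -addrA -scalerDl subrKC.
  - by apply: divr_ge0; lra.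
  - by rewrite ler_pdivrMr; lra.
have Icl a b : (forall u, 0 < u -> u <= 1 -> I (a + u * b)) -> I a.
  move=> H; apply: (scl _ (b *: v)) => u u0 u1.
  by rewrite scalerA -addrA -scalerDl; exact: H.
have [a [b [ab Ia Ib]]] : exists a b, [/\ a < b, I a & I b].
  have [a _ ax] := sl x sx; have [b _ b_y] := sl y sy.
  have Ia : I a by rewrite /I /= ax.
  have Ib : I b by rewrite /I /= b_y.
  have [ab|ba|ab] := ltgtP a b; [by exists a, b|by exists b, a|].
  by case: xy; rewrite -ax -b_y ab.
have infI := is_interval_inf Iitv Icl Ia; have supI := is_interval_sup Iitv Icl Ia.
have [lb|nlb] := pselect (has_lbound I).
- have lbI := ge_inf lb; have {}infI := infI lb.
  have [ub|nub] := pselect (has_ubound I).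
  + have ubI : ubound I (sup I) by apply: sup_upper_bound; split=> //; exists a.
    have {}supI := supI ub.
    have lt : inf I < sup I by have := lbI a Ia; have := ubI b Ib; lra.
    apply: Or32; exists (p + inf I *: v), ((sup I - inf I) *: v); split.
      by rewrite scaler_eq0 negb_or v0 andbT subr_eq0 gt_eqF.
    rewrite sE; apply/seteqP; split=> _ [u Iu <-].
      exists ((u - inf I) / (sup I - inf I)).
        rewrite /= in_itv /=; have := lbI u Iu; have := ubI u Iu => *.
        by rewrite ler_pdivrMr ?ler_pdivlMr; lra.
      by rewrite scalerA divfK ?subr_eq0 ?gt_eqF // -addrA -scalerDl subrKC.
    rewrite scalerA -addrA -scalerDl; apply/line_imageP => //.
    by move: Iu; rewrite /= in_itv /= => u01; apply: (Iitv _ _ infI supI); nra.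
  + apply: Or33; exists (p + inf I *: v), v; split=> //.
    rewrite sE; apply/seteqP; split=> _ [u Iu <-].
      exists (u - inf I); last by rewrite -addrA -scalerDl subrKC.
      by rewrite /= in_itv /= andbT subr_ge0 lbI.
    rewrite -addrA -scalerDl; apply/line_imageP => //.
    have [z Iz uz] : exists2 z, I z & inf I + u < z.
      apply: contrapT => H; apply: nub; exists (inf I + u) => z Iz.
      by rewrite leNgt; apply/negP => uz; apply: H; exists z.
    move: Iu; rewrite /= in_itv /= andbT => u0.
    by apply: (Iitv _ _ infI Iz); lra.
- have below u : exists2 z, I z & z < u.
    apply: contrapT => H; apply: nlb; exists u => z Iz.
    by rewrite leNgt; apply/negP => uz; apply: H; exists z.
  have [ub|nub] := pselect (has_ubound I).
  + have ubI : ubound I (sup I) by apply: sup_upper_bound; split=> //; exists a.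
    have {}supI := supI ub.
    apply: Or33; exists (p + sup I *: v), (- v); split; first by rewrite oppr_eq0.
    rewrite sE; apply/seteqP; split=> _ [u Iu <-].
      exists (sup I - u).
        by rewrite /= in_itv /= andbT subr_ge0 ubI.
      by rewrite scalerN -scaleNr -addrA -scalerDl opprB subrKC.
    rewrite scalerN -scaleNr -addrA -scalerDl; apply/line_imageP => //.
    have [z Iz zu] := below (sup I - u).
    move: Iu; rewrite /= in_itv /= andbT => u0.
    by apply: (Iitv _ _ Iz supI); lra.
  + apply: Or31; exists p, v; split=> //; rewrite sE; congr line_image.
    apply/seteqP; split=> // u _; have [z Iz zu] := below u.
    have [z' Iz' uz'] : exists2 z', I z' & u < z'.
      apply: contrapT => H; apply: nub; exists u => z' Iz'.
      by rewrite leNgt; apply/negP => uz'; apply: H; exists z'.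
    by apply: (Iitv _ _ Iz Iz'); lra.
Qed.

End StringGeometry.

(** * Strings contained in the body of a net *)

Section NetStrings.
Context {R : realType} {d : nat}.
Implicit Types (s t l : set 'rV[R]_d) (N : string_node_pair R d).

Lemma string_sub_line s l x y : is_string s -> is_line l ->
  x <> y -> s x -> s y -> l x -> l y -> s `<=` l.
Proof.
move=> /is_stringP[[l' ll' sl'] _ _ _] ll xy sx sy lx ly.
by rewrite (line_eq ll ll' xy lx ly (sl' x sx) (sl' y sy)).
Qed.

Lemma net_string_eq N s t l x : is_net N -> strings N s -> strings N t ->
  is_line l -> s `<=` l -> t `<=` l -> s x -> t x -> s = t.
Proof.
move=> netN Ss St ll sl tl sx tx; apply: contrapT => st.
have : (s `&` t) x by [].
by rewrite (net_collinear_disjoint netN Ss St st) //; exists l.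
Qed.

Lemma net_string_sub_eq N s t : is_net N -> strings N s -> strings N t ->
  s `<=` t -> s = t.
Proof.
move=> netN Ss St st.
have /is_stringP[_ [x [_ [_ sx _]]] _ _] := net_strings_string netN Ss.
have /is_stringP[[l ll tl] _ _ _] := net_strings_string netN St.
exact: (net_string_eq netN Ss St ll (subset_trans st tl) tl sx (st _ sx)).
Qed.

Lemma string_sub_body N t : is_net N -> is_string t -> t `<=` body N ->
  exists2 s, strings N s & t `<=` s.
Proof.
move=> netN /is_string_param[p [v [I [v0 -> [I0 I1] Iitv _]]]] tN.
set l := line_image p v setT.
have ll : is_line l by exists p, v.
have lu u : l (p + u *: v) by exists u.
(* [g u] is a string of the net through the point with parameter [u], and it is the one lying on [l]
   whenever there is one. This preference makes the fibres of [g] closed and convex. *)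
have /choice[g gP] : forall u, exists s, I u -> [/\ strings N s, s (p + u *: v) &
    forall s', strings N s' -> s' `<=` l -> s' (p + u *: v) -> s = s'].
  move=> u; have [Iu|nIu] := pselect (I u); last by exists set0.
  have [[s [Ss sl su]]|nos] :=
      pselect (exists s, [/\ strings N s, s `<=` l & s (p + u *: v)]).
    exists s => _; split=> // s' Ss' s'l s'u.
    exact: (net_string_eq netN Ss Ss' ll sl s'l su s'u).
  have [|s Ss su] := tN (p + u *: v); first by exists u.
  by exists s => _; split=> // s' Ss' s'l s'u; case: nos; exists s'.
have /countable_injP[h hinj] := net_strings_countable netN.
have ginj u w : I u -> I w -> h (g u) = h (g w) -> g u = g w.
  by move=> /gP[Su _ _] /gP[Sw _ _] /hinj; apply; apply: mem_set.
have gsub u w s : strings N s -> u < w -> s (p + u *: v) -> s (p + w *: v) -> s `<=` l.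
  move=> Ss uw su sw; apply: (string_sub_line (net_strings_string netN Ss) ll _ su sw) => //.
  by move=> /(line_param_inj v0) uw'; rewrite uw' ltxx in uw.
have gcst a b : I a -> I b -> a <= b -> g a = g b.
  move=> Ia Ib ab; have Iab u : a <= u -> u <= b -> I u.
    by move=> au ub; apply: (Iitv a b); rewrite ?au.
  apply: (ginj a b Ia Ib); apply: (countable_closed_convex_fibres (f := h \o g)) ab => /=.
  (* Convexity: a string chosen at two different parameters lies on [l], contains the points in
     between, and is therefore chosen there as well. *)
  - move=> x y z ax; rewrite le_eqVlt => /orP[/eqP->//|xy].
    rewrite le_eqVlt => /orP[/eqP->//|yz] zb.
    have [Ix Iy Iz] : [/\ I x, I y & I z] by split; apply: Iab; lra.
    move=> /(ginj _ _ Ix Iz) gxz; congr h.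
    have [Sx sx _] := gP x Ix; have [_ sz _] := gP z Iz; rewrite -gxz in sz.
    have [_ _ gy] := gP y Iy; apply: gy => //.
      by apply: (gsub x z) => //; exact: lt_trans yz.
    have /is_stringP[_ _ cvx _] := net_strings_string netN Sx.
    rewrite (_ : y = x + (y - x) / (z - x) * (z - x)); last first.
      by field; rewrite subr_eq0 gt_eqF // (lt_trans xy).
    rewrite scalerDl addrA -scalerA; apply: cvx => //.
    + by rewrite -addrA -scalerDl subrKC.
    + by apply: divr_ge0; lra.
    + by rewrite ler_pdivrMr; lra.
  - move=> x y ax xy yb H.
    have Ix : I x by apply: Iab; lra.
    have Iy : I y by apply: Iab; lra.
    have [Sy sy _] := gP y Iy; have [_ _ gx] := gP x Ix; congr h.
    have gyz z : x < z -> z <= y -> g y (p + z *: v).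
      move=> xz zy; have Iz : I z by apply: Iab; lra.
      have <- : g z = g y by apply/ginj => //; exact: H.
      by have [_ sz _] := gP z Iz.
    (* The midpoint and [y] are two points of the half-open interval, which forces [g y] onto [l];
       being closed, it also contains the point at [x]. *)
    apply: gx => //; first by apply: (gsub ((x + y) / 2) y) => //; try apply: gyz; lra.
    have /is_stringP[_ _ _ cls] := net_strings_string netN Sy.
    apply: (cls _ ((y - x) *: v)) => u u0 u1.
    by rewrite scalerA -addrA -scalerDl; apply: gyz; nra.
  - move=> x y ax xy yb H.
    have Ix : I x by apply: Iab; lra.
    have Iy : I y by apply: Iab; lra.
    have [Sx sx _] := gP x Ix; have [_ _ gy] := gP y Iy; congr h.
    have gxz z : x <= z -> z < y -> g x (p + z *: v).
      move=> xz zy; have Iz : I z by apply: Iab; lra.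
      have <- : g z = g x by apply/ginj => //; exact: H.
      by have [_ sz _] := gP z Iz.
    apply: gy => //; first by apply: (gsub x ((x + y) / 2)) => //; try apply: gxz; lra.
    have /is_stringP[_ _ _ cls] := net_strings_string netN Sx.
    apply: (cls _ ((x - y) *: v)) => u u0 u1.
    by rewrite scalerA -addrA -scalerDl; apply: gxz; nra.
exists (g 0); first by have [] := gP 0 I0.
move=> _ [u Iu <-]; have [_ gu _] := gP u Iu.
by have [u0|/ltW u0] := leP 0 u; [rewrite (gcst 0 u)|rewrite -(gcst u 0)].
Qed.

(** Two distinct strings of [S] that meet cannot lie in the same string of [S'], since they would
    then be collinear. *)
Lemma intersection_points_sub (S S' : set (set 'rV[R]_d)) :
  (forall s t, S s -> S t -> s <> t -> collinear s t -> s `&` t = set0) ->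
  (forall s, S' s -> is_string s) ->
  (forall s, S s -> exists2 s', S' s' & s `<=` s') ->
  intersection_points S `<=` intersection_points S'.
Proof.
move=> disj strS' SS' x [s [t [Ss St st sx tx]]].
have [s' Ss' ss'] := SS' s Ss; have [t' St' tt'] := SS' t St.
exists s', t'; split; [by []|by []| |exact: ss'|exact: tt'].
move=> s't'; rewrite -s't' in tt'.
have /is_stringP[[l ll s'l] _ _ _] := strS' s' Ss'.
have : (s `&` t) x by [].
by rewrite disj //; exists l; split=> //; exact: subset_trans s'l.
Qed.

(** Each pair of distinct strings contributes at most one point: two common points would make the
    strings collinear, hence disjoint. *)
Lemma intersection_points_countable (S : set (set 'rV[R]_d)) :
  countable S -> (forall s, S s -> is_string s) ->
  (forall s t, S s -> S t -> s <> t -> collinear s t -> s `&` t = set0) ->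
  countable (intersection_points S).
Proof.
move=> cS strS disj.
pose F (st : set 'rV[R]_d * set 'rV[R]_d) := [set x | st.1 <> st.2 /\ (st.1 `&` st.2) x].
apply: (@sub_countable _ _ _ (\bigcup_(st in S `*` S) F st)).
  by apply: subset_card_le => x [s [t [Ss St st sx tx]]]; exists (s, t).
apply: bigcup_countable => [|[s t] [/= Ss St]]; first exact: countableX.
have [[x [/= st [sx tx]]]|F0] := pselect (F (s, t) !=set0); last first.
  by rewrite (_ : F _ = set0) //; apply/seteqP; split=> // x Fx; case: F0; exists x.
apply: (@sub_countable _ _ _ [set x]); last exact: countable1.
apply: subset_card_le => y [/= _ [sy ty]]; apply: contrapT => yx.
have [[l ll sl] _ _ _] := (is_stringP s).1 (strS s Ss).
have tl := string_sub_line (strS t St) ll yx ty tx (sl y sy) (sl x sx).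
have : (s `&` t) x by [].
by rewrite disj //; exists l.
Qed.

Lemma net_extension N N' : is_net N -> is_net N' -> body N `<=` body N' ->
  is_extension N N'.
Proof.
move=> netN netN' NN'; split=> //; rewrite (net_nodesE netN) (net_nodesE netN').
apply: intersection_points_sub => [||s Ss].
- exact: net_collinear_disjoint.
- exact: net_strings_string.
- apply: string_sub_body => //; first exact: (net_strings_string netN).
  by move=> x sx; apply: NN'; exists s.
Qed.

Lemma net_eq_of_body N N' : is_net N -> is_net N' -> body N = body N' -> N = N'.
Proof.
move=> netN netN' NN'.
have sub (M M' : string_node_pair R d) :
    is_net M -> is_net M' -> body M = body M' -> strings M `<=` strings M'.
  move=> netM netM' MM' s Ss.
  (* Passing to [M'] and back yields [s], [s'], [s''] in increasing order with both ends in [M]; the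
     ends coincide, so all three are equal. *)
  have [|s' Ss' ss'] := string_sub_body netM' (net_strings_string netM Ss).
    by rewrite -MM' => x sx; exists s.
  have [|s'' Ss'' s's''] := string_sub_body netM (net_strings_string netM' Ss').
    by rewrite MM' => x sx; exists s'.
  have ss'' : s = s''.
    by apply: (net_string_sub_eq netM) => //; exact: subset_trans s's''.
  by rewrite (_ : s = s') //; apply/seteqP; split=> //; rewrite ss''.
have SS' : strings N = strings N' by apply/seteqP; split; apply: sub.
have nn' : nodes N = nodes N' by rewrite !net_nodesE // SS'.
by case: N N' SS' nn' {netN netN' NN'} => ? ? [? ?] /= -> ->.
Qed.

End NetStrings.

(** * The least invariant extension *)

Section Dilation.
Context {R : realType} {d : nat}.
Implicit Types (s t l : set 'rV[R]_d) (N : string_node_pair R d) (r : R).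

Definition dilate r s := [set r *: x | x in s].

Lemma dilateK r s : r != 0 -> dilate r^-1 (dilate r s) = s.
Proof.
move=> r0; apply/seteqP; split=> [_ [_ [x sx <-] <-]|x sx].
  by rewrite scalerA mulVf ?scale1r.
by exists (r *: x); [exists x|rewrite scalerA mulVf ?scale1r].
Qed.

Lemma dilateVK r s : r != 0 -> dilate r (dilate r^-1 s) = s.
Proof. by move=> r0; rewrite -{1}[r]invrK dilateK // invr_eq0. Qed.

Lemma dilateM r r' s : dilate r (dilate r' s) = dilate (r * r') s.
Proof.
apply/seteqP; split=> [_ [_ [x sx <-] <-]|_ [x sx <-]].
  by exists x; rewrite ?scalerA.
by exists (r' *: x); [exists x|rewrite scalerA].
Qed.

Lemma dilate1 s : dilate 1 s = s.
Proof.
by apply/seteqP; split=> [_ [x sx <-]|x sx]; [rewrite scale1r|exists x; rewrite ?scale1r].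
Qed.

Lemma dilate_line_image r p v (I : set R) :
  dilate r (line_image p v I) = line_image (r *: p) (r *: v) I.
Proof.
have E u : r *: (p + u *: v) = r *: p + u *: (r *: v).
  by rewrite scalerDr !scalerA mulrC.
apply/seteqP; split=> [_ [_ [u Iu <-] <-]|_ [u Iu <-]].
  by exists u; rewrite ?E.
by exists (p + u *: v); [exists u|].
Qed.

Lemma is_line_dilate r l : r != 0 -> is_line l -> is_line (dilate r l).
Proof.
move=> r0 [p [v [v0 ->]]]; exists (r *: p), (r *: v).
by rewrite dilate_line_image scaler_eq0 negb_or r0.
Qed.

Lemma is_string_dilate r s : r != 0 -> is_string s -> is_string (dilate r s).
Proof.
move=> r0 [] [p [v [v0 ->]]]; rewrite dilate_line_image;
  [apply: Or31|apply: Or32|apply: Or33]; exists (r *: p), (r *: v);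
  by rewrite scaler_eq0 negb_or r0.
Qed.

Lemma dilate_body N r s : scaling_group N r -> s `<=` body N -> dilate r s `<=` body N.
Proof. by move=> [_ rN] sN _ [x sx <-]; rewrite -rN; exists x => //; exact: sN. Qed.

End Dilation.

(** * Hulls of the dilated strings and the net they form *)

Section Hull.
Context {R : realType} {d : nat} (N : string_node_pair R d) (U : set R).
Hypotheses (netN : is_net N) (countableU : countable U)
  (subgroupU : is_mul_subgroup U (@positive_reals R)).
Implicit Types (b s t l : set 'rV[R]_d).

Definition invariant_extension (N' : string_node_pair R d) :=
  is_extension N N' /\ is_mul_subgroup U (scaling_group N').

(* The lines through [b] are included so that [hull b] lies on a line even
   before any invariant extension is known to exist. *)
Definition hull b : set 'rV[R]_d :=
  [set x | (forall l, is_line l -> b `<=` l -> l x) /\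
    forall N' s, invariant_extension N' -> strings N' s -> b `<=` s -> s x].

(** Distinct collinear members may overlap, so these sets need not be the strings of a net; passing
    to hulls merges those that overlap. *)
Definition dilated_strings : set (set 'rV[R]_d) :=
  [set dilate rs.1 rs.2 | rs in U `*` strings N].

Definition hull_net : string_node_pair R d :=
  let S := hull @` dilated_strings in StringNodePair (intersection_points S) S.

Let U_neq0 r : U r -> r != 0.
Proof. by move=> /(mul_subgroup_sub subgroupU) /lt0r_neq0. Qed.

Lemma dilated_string_is_string b : dilated_strings b -> is_string b.
Proof.
move=> [[r s] [/= Ur Ss] <-]; apply: is_string_dilate; first exact: U_neq0.
exact: (net_strings_string netN).
Qed.

Lemma invariant_extension_net N' : invariant_extension N' -> is_net N'.
Proof. by move=> [[]]. Qed.

Lemma invariant_extension_cover N' b : invariant_extension N' -> dilated_strings b ->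
  exists2 s, strings N' s & b `<=` s.
Proof.
move=> [[netN' _ NN'] UN'] Bb.
apply: string_sub_body netN' (dilated_string_is_string Bb) _.
case: Bb => -[r s] [/= Ur Ss] <-; apply: dilate_body.
  exact: (mul_subgroup_sub UN').
by move=> x sx; apply: NN'; exists s.
Qed.

Lemma sub_hull b : b `<=` hull b.
Proof. by move=> x bx; split=> [l _|N' s _ _]; exact. Qed.

(** A hull is an intersection of lines and strings, so it inherits convexity and closedness; it is
    nondegenerate because it contains [b]. *)
Lemma hull_is_string b : is_string b -> is_string (hull b).
Proof.
move=> /is_stringP[[l ll bl] [x [y [xy bx b_y]]] _ _]; apply/is_stringP.
have line_str (k : set 'rV[R]_d) : is_line k -> is_string k by move=> lk; apply: Or31.
split.
- by exists l => // z [H _]; exact: H.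
- by exists x, y; split=> //; exact: sub_hull.
- move=> z w u [zl zs] [wl ws] u0 u1; split=> [k lk bk|N' s eN' Ss bs].
    by have /is_stringP[_ _ cvx _] := line_str k lk; apply: cvx => //; [exact: zl|exact: wl].
  have /is_stringP[_ _ cvx _] := net_strings_string (invariant_extension_net eN') Ss.
  by apply: cvx => //; [exact: zs eN' Ss bs|exact: ws eN' Ss bs].
- move=> z w H; split=> [k lk bk|N' s eN' Ss bs].
    have /is_stringP[_ _ _ cls] := line_str k lk.
    by apply: (cls _ w) => u u0 u1; have [Hl _] := H u u0 u1; exact: Hl.
  have /is_stringP[_ _ _ cls] := net_strings_string (invariant_extension_net eN') Ss.
  by apply: (cls _ w) => u u0 u1; have [_ Hs] := H u u0 u1; exact: Hs eN' Ss bs.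
Qed.

(** In any invariant extension, the strings containing [b] and [b'] lie on [l] and share [x], so
    they are the same string. Both hulls are thus cut out by the same strings. *)
Lemma hull_sub b b' l x : dilated_strings b -> dilated_strings b' -> is_line l ->
  hull b `<=` l -> hull b' `<=` l -> hull b x -> hull b' x -> hull b `<=` hull b'.
Proof.
move=> Bb Bb' ll bl b'l bx b'x y hy.
have on_line (N' : string_node_pair R d) s b0 : is_net N' -> strings N' s ->
    is_string b0 -> b0 `<=` l -> b0 `<=` s -> s `<=` l.
  move=> netN' Ss /is_stringP[_ [z [w [zw b0z b0w]]] _ _] b0l b0s.
  by apply: (string_sub_line (net_strings_string netN' Ss) ll zw);
    [exact: b0s|exact: b0s|exact: b0l|exact: b0l].
have strb := dilated_string_is_string Bb; have strb' := dilated_string_is_string Bb'.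
have {}bl' : b `<=` l := subset_trans (@sub_hull b) bl.
have {}b'l' : b' `<=` l := subset_trans (@sub_hull b') b'l.
split=> [k lk b'k|N' s eN' Ss b's].
  have /is_stringP[_ [z [w [zw b'z b'w]]] _ _] := strb'.
  rewrite -(line_eq ll lk zw (b'l' _ b'z) (b'l' _ b'w) (b'k _ b'z) (b'k _ b'w)).
  exact: bl.
have [s' Ss' bs'] := invariant_extension_cover eN' Bb.
have netN' := invariant_extension_net eN'.
have sl := on_line _ _ _ netN' Ss strb' b'l' b's.
have s'l := on_line _ _ _ netN' Ss' strb bl' bs'.
have sx : s x by exact: b'x.2 eN' Ss b's.
have s'x : s' x by exact: bx.2 eN' Ss' bs'.
rewrite (net_string_eq netN' Ss Ss' ll sl s'l sx s'x).
exact: hy.2 eN' Ss' bs'.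
Qed.

(** Scaling by [r] permutes the strings of an invariant extension. A string [s] containing
    [dilate r b] is carried by the inverse into some [s1], and [s1] is carried by [r] into some
    [s2]; then [s] lies in [s2], so they are equal, and [x] in [s1] gives [r *: x] in [s]. *)
Lemma hull_dilate b r x : U r -> hull b x -> hull (dilate r b) (r *: x).
Proof.
move=> Ur [xl xs]; have r0 := U_neq0 Ur.
split=> [l ll rbl|N' s eN' Ss rbs].
  rewrite -(dilateVK l r0); exists x => //; apply: xl.
    by apply: is_line_dilate => //; rewrite invr_eq0.
  by rewrite -(dilateK b r0); exact: image_subset.
have [[netN' _ _] UN'] := eN'; have strs := net_strings_string netN' Ss.
have UVr := mul_subgroup_sub UN' (mul_subgroupV UN' Ur).
have sN' : s `<=` body N' by move=> y sy; exists s.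
have [|s1 Ss1 rs1] := string_sub_body netN'
  (is_string_dilate _ strs) (dilate_body UVr sN').
  by rewrite invr_eq0.
have s1N' : s1 `<=` body N' by move=> y sy; exists s1.
have [s2 Ss2 rs2] := string_sub_body netN'
  (is_string_dilate r0 (net_strings_string netN' Ss1))
  (dilate_body (mul_subgroup_sub UN' Ur) s1N').
have ss2 : s `<=` s2.
  by apply: subset_trans rs2; rewrite -(dilateVK s r0); exact: image_subset.
rewrite (net_string_sub_eq netN' Ss Ss2 ss2); apply: rs2; exists x => //.
apply: (xs N' s1 eN' Ss1); apply: subset_trans rs1.
by rewrite -(dilateK b r0); exact: image_subset.
Qed.

Lemma string_sub_hull_net s : strings N s ->
  exists2 t, strings hull_net t & s `<=` t.
Proof.
move=> Ss; exists (hull (dilate 1 s)); last by rewrite dilate1; exact: sub_hull.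
exists (dilate 1 s) => //; exists (1, s) => //.
by split=> //; exact: mul_subgroup1 subgroupU.
Qed.

Lemma hull_net_collinear_disjoint s t :
  strings hull_net s -> strings hull_net t -> s <> t -> collinear s t -> s `&` t = set0.
Proof.
move=> [b Bb <-] [b' Bb' <-] bb' [l [ll bl b'l]]; apply/seteqP; split=> // x [bx b'x].
apply: bb'; apply/seteqP; split; [exact: (@hull_sub b b' l x)|exact: (@hull_sub b' b l x)].
Qed.

Lemma hull_net_is_net : is_net hull_net.
Proof.
have strS s : strings hull_net s -> is_string s.
  by move=> [b Bb <-]; apply/hull_is_string/dilated_string_is_string.
have disj := hull_net_collinear_disjoint.
have cS : countable (strings hull_net).
  apply: (sub_countable (card_image_le _ _)).
  apply: (sub_countable (card_image_le _ _)).
  by apply: countableX => //; exact: (net_strings_countable netN).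
split=> //.
- have [s Ss] := net_strings_nonempty netN.
  by have [t St _] := string_sub_hull_net Ss; exists t.
(* A node of [N] stays a node, because the two strings crossing there lie in different hulls. *)
- have [x] := net_nodes_nonempty netN; rewrite (net_nodesE netN) => Nx; exists x.
  apply: intersection_points_sub x Nx => //.
    exact: net_collinear_disjoint.
  exact: string_sub_hull_net.
- exact: intersection_points_countable.
Qed.

Lemma hull_net_extension : is_extension N hull_net.
Proof.
apply: net_extension netN hull_net_is_net _ => x [s Ss sx].
by have [t St st] := string_sub_hull_net Ss; exists t => //; exact: st.
Qed.

Lemma hull_net_invariant : is_mul_subgroup U (scaling_group hull_net).
Proof.
have stable r x : U r -> body hull_net x -> body hull_net (r *: x).
  move=> Ur [_ [b Bb <-] bx]; exists (hull (dilate r b)); last exact: hull_dilate.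
  exists (dilate r b) => //; case: Bb => -[r' s] [/= Ur' Ss] <-.
  exists (r * r', s); last by rewrite dilateM.
  by split=> //; exact: mul_subgroupM subgroupU _ _ Ur Ur'.
have [sub U1 UM UV] := subgroupU; split=> // r Ur; split; first exact: sub.
apply/seteqP; split=> [_ [x Nx <-]|x Nx]; first exact: stable.
exists (r^-1 *: x); first by apply: stable => //; exact: UV.
by rewrite scalerA mulfV ?scale1r // U_neq0.
Qed.

Lemma hull_net_minimal N' : invariant_extension N' -> is_extension hull_net N'.
Proof.
move=> eN'; have netN' := invariant_extension_net eN'.
apply: net_extension hull_net_is_net netN' _ => x [_ [b Bb <-] [_ bx]].
have [s Ss bs] := invariant_extension_cover eN' Bb.
by exists s => //; exact: bx eN' Ss bs.
Qed.

End Hull.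

Theorem theorem4p7 (R : realType) (d : nat) (N : string_node_pair R d)
    (U : set R) (netN : is_net N) (countableU : countable U)
    (subgroupU : is_mul_subgroup U (@positive_reals R)) :
  exists! NU : string_node_pair R d,
    [/\ is_extension N NU,
        is_mul_subgroup U (scaling_group NU)
      & forall N' : string_node_pair R d,
          is_extension N N' -> is_mul_subgroup U (scaling_group N') ->
          is_extension NU N'].
Proof.
exists (hull_net N U); split.
  split; [exact: hull_net_extension|exact: hull_net_invariant|].
  by move=> N' eN' UN'; exact: hull_net_minimal.
(* Two least invariant extensions extend each other, so they have the same body, and the body
   determines the net. *)
move=> N' [eN' UN' minN'].
have [netH _ HN'] : is_extension (hull_net N U) N' by exact: hull_net_minimal.
have [netN' _ N'H] : is_extension N' (hull_net N U).
  by apply: minN'; [exact: hull_net_extension|exact: hull_net_invariant].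
by apply: net_eq_of_body => //; apply/seteqP.
Qed.
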